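(* Let $\Gamma$ be a finite simple unweighted digraph of order $n$, where $n$ is square-free or $n=2m$ with $m$ square-free. If $\Gamma$ is a restricted-normal digraph, then $\Gamma$ is a directed join of two normal digraphs.
   Context: The Laplacian is $L=D-A$ with $A$ the adjacency matrix (no loops) and $D$ the diagonal matrix of out-degrees. $\mathbf{e}$ is the all-ones vector; a restrictor matrix of order $n$ is an $n\times(n-1)$ matrix $Q$ with orthonormal columns orthogonal to $\mathbf{e}$. A digraph is normal if $L$ is normal, and restricted-normal if $L$ is not normal but $Q^*LQ$ is normal (independent of the choice of $Q$). For $\Gamma_1=(V_1,E_1)$, $\Gamma_2=(V_2,E_2)$ with $V_1\cap V_2=\emptyset$, the directed join is $\Gamma_1\overset{\rightarrow}{\vee}\Gamma_2=(V_1\sqcup V_2,E_1\sqcup E_2\sqcup\{(i,j):i\in V_1,j\in V_2\})$. *)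

(* Defs.v *)
From HB Require Import structures.
From mathcomp Require Import all_boot all_order all_algebra.

Set Implicit Arguments.
Unset Strict Implicit.
Unset Printing Implicit Defensive.

Import Order.TTheory GRing.Theory Num.Theory.
Local Open Scope ring_scope.
Local Open Scope sesquilinear_scope.

(* Antiparallel edges (i, j), (j, i) are allowed. *)
Record digraph := Digraph {
  vertex : finType;
  edge : rel vertex;
  edge_irrefl : irreflexive edge
}.

Definition digraph_order (G : digraph) : nat := #|vertex G|.

Definition outdegree (G : digraph) (x : vertex G) : nat := #|[set y | edge x y]|.

(* The complex field is an arbitrary [numClosedFieldType]; vertices are
   numbered by [enum_val]. *)
Definition adjacency (C : numClosedFieldType) (G : digraph) :
    'M[C]_(digraph_order G) :=
  \matrix_(i, j) (edge (enum_val i) (enum_val j))%:R.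

Definition degree_mx (C : numClosedFieldType) (G : digraph) :
    'M[C]_(digraph_order G) :=
  diag_mx (\row_i (outdegree (enum_val i))%:R).

Definition laplacian (C : numClosedFieldType) (G : digraph) :
    'M[C]_(digraph_order G) :=
  degree_mx C G - adjacency C G.

Definition restrictor (C : numClosedFieldType) (n : nat)
    (Q : 'M[C]_(n, n.-1)) : Prop :=
  Q^t* *m Q = 1%:M /\ Q^t* *m (const_mx 1 : 'cV[C]_n) = 0.

Definition normal_digraph (C : numClosedFieldType) (G : digraph) : Prop :=
  laplacian C G \is normalmx.

(* Normality of Q^* L Q does not depend on the restrictor Q: two restrictors
   of the same order differ by a unitary factor on the right. *)
Definition restricted_normal (C : numClosedFieldType) (G : digraph) : Prop :=
  ~ normal_digraph C G /\
  exists2 Q : 'M[C]_(digraph_order G, (digraph_order G).-1),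
    restrictor Q & Q^t* *m laplacian C G *m Q \is normalmx.

Definition join_edge (G1 G2 : digraph) : rel (vertex G1 + vertex G2)%type :=
  fun u v => match u, v with
  | inl x, inl y => edge x y
  | inr x, inr y => edge x y
  | inl _, inr _ => true
  | inr _, inl _ => false
  end.

Lemma join_edge_irrefl (G1 G2 : digraph) : irreflexive (@join_edge G1 G2).
Proof. by case=> x; apply: edge_irrefl. Qed.

Definition directed_join (G1 G2 : digraph) : digraph :=
  Digraph (@join_edge_irrefl G1 G2).

Definition isomorphic (G H : digraph) : Prop :=
  exists2 f : vertex G -> vertex H,
    bijective f & forall x y, edge (f x) (f y) = edge x y.

Definition square_free (n : nat) : Prop :=
  forall d : nat, (d ^ 2 %| n)%N -> d = 1%N.

(* Main.v *)
(** Write c(x) for the out-degree minus the in-degree of x, and let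
    X = L L^T - L^T L, whose diagonal is c.  Since Q Q^* = I - J/n, restricted
    normality says that X + c c^T / n vanishes, as a quadratic form, on
    differences of basis vectors; evaluated at e_x - e_y this is
      n (2 X_xy - c(x) - c(y)) = (c(x) - c(y))^2.
    With this parity information, the arithmetic hypothesis on n forces
    n | c(x) - c(y).  As |c| < n, sum c = 0 and c <> 0 (otherwise X = 0),
    c takes exactly two values, namely |~A| on A = {c > 0} and -|A| on ~A.
    Summing c over A shows that all arcs from A to ~A, and none from ~A to A,
    are present.  Then X_xy = c(x) on each of the two blocks, which is exactly
    the contribution of the join arcs, so both induced digraphs are normal. *)
Require Import Defs.
From mathcomp Require Import all_boot all_order all_algebra.
From mathcomp Require Import ring zify.

Set Implicit Arguments.
Unset Strict Implicit.
Unset Printing Implicit Defensive.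

Import Order.TTheory GRing.Theory Num.Theory.
Local Open Scope ring_scope.
Local Open Scope sesquilinear_scope.

(** * Divisibility by square-free numbers *)

(** Divide by [g = gcdn n d]: the cofactor [n'] of [n] is coprime to that of [d], so it divides [g].
    Then [n'^2] divides [n' * g = n], whence [n' = 1]. *)
Lemma square_free_dvd_sqr (n d : nat) :
  square_free n -> (n %| d ^ 2)%N -> (n %| d)%N.
Proof.
move=> sfn.
case: (posnP n) => [n0|n_gt0]; first by have := sfn 2 _; rewrite n0 dvdn0 => /(_ isT).
have : (0 < gcdn n d)%N by rewrite gcdn_gt0 n_gt0.
have /dvdnP[n' En] := dvdn_gcdl n d; have /dvdnP[d' Ed] := dvdn_gcdr n d => g_gt0.
have cop : coprime n' d'.
  by rewrite /coprime -(eqn_pmul2r g_gt0) mul1n muln_gcdl -En -Ed.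
move: (gcdn n d) g_gt0 En Ed => g g_gt0 En Ed.
rewrite Ed expnMn (expnS g) expn1 mulnA En dvdn_pmul2r //.
rewrite (Gauss_dvdr _ (coprimeXr 2 cop)) => dvd_n'g.
have n'1 : n' = 1%N by apply: sfn; rewrite En expnS expn1 dvdn_mul.
by rewrite n'1 mul1n dvdn_mull.
Qed.

Lemma square_free_dvdz_sqr (n : nat) (d : int) :
  square_free n -> (n %| d ^+ 2)%Z -> (n %| d)%Z.
Proof. by move=> sfn; rewrite !dvdzE abszX; apply: square_free_dvd_sqr. Qed.

(** The cofactor [d + 2 * z] has the parity of [d]. For even [n] this is essential: 4 divides
    [2 ^ 2] but not 2. *)
Lemma dvdz_of_sqr_eq (n : nat) (d z : int) :
    square_free n \/ (exists2 m : nat, square_free m & n = (2 * m)%N) ->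
    n%:Z * (d + 2 * z) = d ^+ 2 -> (n %| d)%Z.
Proof.
case=> [sfn|[m sfm ->]] eq_d.
  by apply: square_free_dvdz_sqr; rewrite // -eq_d dvdz_mulr.
have m_neq0 : m%:Z != 0.
  by apply/eqP => -[m0]; have := sfm 2; rewrite m0 dvdn0 => /(_ isT).
have /dvdzP[r Er] : (m %| d)%Z.
  by apply: square_free_dvdz_sqr; rewrite // -eq_d PoszM mulrAC dvdz_mull.
have eq_r : m%:Z * r ^+ 2 = 2 * (m%:Z * r + 2 * z).
  apply: (mulfI m_neq0); move: eq_d; rewrite Er PoszM => eq_d.
  have -> : m%:Z * (m%:Z * r ^+ 2) = (r * m%:Z) ^+ 2 by ring.
  by rewrite -eq_d; ring.
have [q [Eq|Eq]] : exists q : int, r = 2 * q \/ r = 2 * q + 1.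
  by exists (r %/ 2)%Z; lia.
  by rewrite Er Eq PoszM; apply/dvdzP; exists q; ring.
(* An odd r would make the square-free m a multiple of 4. *)
have Em : m%:Z = (m%:Z * q ^+ 2 - z) * 4 by rewrite Eq in eq_r; lia.
by have := sfm 2; rewrite -[(_ %| _)%N]/(4%:Z %| m%:Z)%Z Em dvdz_mull // => /(_ isT).
Qed.

(** * Restricted normality as a quadratic identity *)

Section Restrictor.
Variables (C : numClosedFieldType).

(** The square matrix with columns [e] and [Q] has as left inverse the rows [e^T / n] and [Q^t*].
    This is also a right inverse, and expanding that product gives the claim. *)
Lemma restrictor_proj n (Q : 'M[C]_(n, n.-1)) :
  (0 < n)%N -> restrictor Q -> Q *m Q^t* = 1%:M - n%:R^-1 *: const_mx 1.
Proof.
case: n Q => // m Q _ [QQ Qe] /=.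
pose e : 'cV[C]_m.+1 := const_mx 1.
have ee : e^T *m e = m.+1%:R%:M.
  apply/matrixP=> i j; rewrite !mxE !ord1 (eq_bigr (fun=> 1)); last first.
    by move=> k _; rewrite !mxE mulr1.
  by rewrite sumr_const card_ord.
have eQ : e^T *m Q = 0.
  apply/matrixP=> i j; have /matrixP/(_ j i)/(congr1 Num.conj) := Qe.
  rewrite !mxE rmorph0 rmorph_sum /=; apply: etrans; apply: eq_bigr => k _.
  by rewrite !mxE rmorphM /= conjCK conjC1 mulr1 mul1r.
pose A : 'M[C]_(1 + m, m.+1) := col_mx (m.+1%:R^-1 *: e^T) (Q^t* : 'M_(m, m.+1)).
pose B : 'M[C]_(m.+1, 1 + m) := row_mx e (Q : 'M_(m.+1, m)).
have AB1 : A *m B = 1%:M.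
  rewrite mul_col_row -!scalemxAl ee eQ QQ Qe scaler0 scalar_mx_block.
  by rewrite scale_scalar_mx mulVf // pnatr_eq0.
have := mulmx1C AB1; rewrite /A /B mul_row_col -scalemxAr => <-.
suff -> : e *m e^T = const_mx 1 by rewrite addrC addKr.
by apply/matrixP=> i j; rewrite !mxE big_ord1 !mxE mulr1.
Qed.

(** Multiplying the normality equation by [Q] on the left and [Q^t*] on the right turns it into one
    about [P = Q *m Q^t*]. Since [P] fixes [u] and [L *m P = L], only one inner [P] survives, on the
    right; its part [- e *m e^T / n] yields the rank-one correction. *)
Lemma restricted_quad n (L : 'M[C]_n) (Q : 'M[C]_(n, n.-1)) (u : 'rV[C]_n) :
    (0 < n)%N -> restrictor Q -> Q^t* *m L *m Q \is normalmx ->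
    L^t* = L^T -> L *m (const_mx 1 : 'cV_n) = 0 -> u *m (const_mx 1 : 'cV_n) = 0 ->
  u *m L *m (u *m L)^T =
    (L *m u^T)^T *m (L *m u^T) -
    n%:R^-1 *: ((u *m (L^T *m (const_mx 1 : 'cV_n))) *m (u *m (L^T *m (const_mx 1 : 'cV_n)))^T).
Proof.
move=> n_gt0 resQ /normalmxP nQ Lr Le ue.
have PE := restrictor_proj n_gt0 resQ.
set P := Q *m Q^t* in PE.
pose e : 'cV[C]_n := const_mx 1.
have JE : const_mx 1 = e *m e^T.
  by apply/matrixP=> i j; rewrite !mxE big_ord1 !mxE mulr1.
rewrite -/e in Le ue *.
have PT : P^T = P by rewrite PE linearB linearZ /= trmx1 trmx_const.
have LP : L *m P = L.
  by rewrite PE mulmxBr mulmx1 -scalemxAr JE mulmxA Le mul0mx scaler0 subr0.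
have uP : u *m P = u.
  by rewrite PE mulmxBr mulmx1 -scalemxAr JE mulmxA ue mul0mx scaler0 subr0.
have PL : P *m L^T = L^T by rewrite -{2}LP trmx_mul PT.
have Pu : P *m u^T = u^T by rewrite -{2}uP trmx_mul PT.
have key : P *m L *m P *m L^T *m P = P *m L^T *m P *m L *m P.
  have := congr1 (fun M => Q *m M *m Q^t*) nQ.
  by rewrite !trmx_mul !map_mxM /= trmxCK Lr /P !mulmxA.
clearbody P; have := congr1 (fun M => u *m M *m u^T) key.
rewrite /= !mulmxA uP.
rewrite -!(mulmxA _ P u^T) !Pu -(mulmxA u L P) LP !trmx_mul trmxK !mulmxA => ->.
rewrite PE !(mulmxBr, mulmxBl) mulmx1 -scalemxAr -!scalemxAl JE.
by rewrite !trmxK !mulmxA.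
Qed.

Lemma restricted_normal_entries n (L : 'M[C]_n) (Q : 'M[C]_(n, n.-1)) :
    (0 < n)%N -> restrictor Q -> Q^t* *m L *m Q \is normalmx ->
    L^t* = L^T -> (forall i, \sum_j L i j = 0) ->
  forall i j, \sum_k (L i k - L j k) ^+ 2 =
    \sum_k (L k i - L k j) ^+ 2 - n%:R^-1 * (\sum_k L k i - \sum_k L k j) ^+ 2.
Proof.
move=> n_gt0 resQ nQ Lr L0 i j.
pose u : 'rV[C]_n := delta_mx 0 i - delta_mx 0 j.
have Le : L *m (const_mx 1 : 'cV_n) = 0.
  apply/matrixP=> a b; rewrite !mxE -[RHS](L0 a).
  by apply: eq_bigr => k _; rewrite !mxE mulr1.
have ue : u *m (const_mx 1 : 'cV_n) = 0.
  by rewrite mulmxBl -!rowE; apply/matrixP=> a b; rewrite !mxE subrr.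
have uL a k : (u *m L) a k = L i k - L j k by rewrite mulmxBl -!rowE !mxE.
have Lu a k : (L *m u^T) k a = L k i - L k j.
  by rewrite linearB /= !trmx_delta mulmxBr -!colE !mxE.
have uc a b : (u *m (L^T *m (const_mx 1 : 'cV_n))) a b = \sum_k L k i - \sum_k L k j.
  rewrite mulmxBl -!rowE !mxE.
  by congr (_ - _); apply: eq_bigr => k _; rewrite !mxE mulr1.
have := restricted_quad n_gt0 resQ nQ Lr Le ue.
move: (u *m L) (L *m u^T) (u *m (L^T *m _)) uL Lu uc => A B c AE BE cE.
move=> /matrixP/(_ 0 0); rewrite !mxE big_ord1 mxE !cE -expr2 => eqQ.
have <- : \sum_k A 0 k * A^T k 0 = \sum_k (L i k - L j k) ^+ 2.
  by apply: eq_bigr => k _; rewrite mxE !AE expr2.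
rewrite eqQ; congr (_ - _).
by apply: eq_bigr => k _; rewrite mxE !BE expr2.
Qed.

End Restrictor.

(** * The Laplacian over the integers *)

Lemma sum_deltal (T : finType) (x : T) (F : T -> int) : \sum_y (x == y)%:R * F y = F x.
Proof.
rewrite (bigD1 x) //= eqxx mul1r big1 ?addr0 // => y /negPf yx.
by rewrite eq_sym yx mul0r.
Qed.

Lemma sum_deltar (T : finType) (x : T) (F : T -> int) : \sum_y (y == x)%:R * F y = F x.
Proof. by under eq_bigr do rewrite eq_sym; exact: sum_deltal. Qed.

Section Laplacian.
Variable G : digraph.
Implicit Types x y z : vertex G.

(** Integer values make divisibility available. *)
Definition lap x y : int := (outdegree x)%:R * (x == y)%:R - (edge x y)%:R.

Definition excess x : int := \sum_y ((edge x y)%:R - (edge y x)%:R).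

(** The entries of [X = L L^T - L^T L]. *)
Definition defect x y : int := \sum_z (lap x z * lap y z - lap z x * lap z y).

Lemma sum_edge x : \sum_y (edge x y)%:R = (outdegree x)%:R :> int.
Proof.
rewrite -natr_sum /outdegree -sum1_card [in RHS]big_mkcond /=.
by congr (_%:R); apply: eq_bigr => y _; rewrite inE; case: edge.
Qed.

Lemma sum_lap_row x : \sum_y lap x y = 0.
Proof.
rewrite sumrB sum_edge; under eq_bigr do rewrite mulrC.
by rewrite (sum_deltal x (fun=> _)) subrr.
Qed.

Lemma sum_lap_col x : \sum_y lap y x = excess x.
Proof.
rewrite /lap /excess !sumrB sum_edge; under eq_bigr do rewrite mulrC.
by rewrite sum_deltar.
Qed.

(** The squared degrees cancel, and off the diagonal the square of an entry is the edge indicator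
    itself. *)
Lemma defect_diag x : defect x x = excess x.
Proof.
have sq y z : lap y z * lap y z = (y == z)%:R * (outdegree y)%:R ^+ 2 + (edge y z)%:R.
  rewrite /lap; case: eqP => [<-|_]; first by rewrite edge_irrefl /=; ring.
  by case: edge => /=; ring.
rewrite /defect (eq_bigr (fun z => (x == z)%:R * (outdegree x)%:R ^+ 2 -
  (z == x)%:R * (outdegree z)%:R ^+ 2 + ((edge x z)%:R - (edge z x)%:R))); last first.
  by move=> z _; rewrite !sq; ring.
rewrite big_split sumrB /= -/(excess x) (sum_deltal x (fun=> _)).
by rewrite (sum_deltar x (fun z => (outdegree z)%:R ^+ 2)) subrr add0r.
Qed.

Lemma excess_sum : \sum_x excess x = 0.
Proof. by rewrite /excess; under eq_bigr do rewrite sumrB; rewrite sumrB exchange_big subrr. Qed.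

Variable C : numClosedFieldType.
Local Notation n := (digraph_order G).

Lemma laplacianE i j : laplacian C G i j = (lap (enum_val i) (enum_val j))%:~R.
Proof.
rewrite /laplacian /lap !mxE (inj_eq enum_val_inj) rmorphB rmorphM /= !rmorph_nat.
by rewrite mulr_natr.
Qed.

Lemma laplacian_real : (laplacian C G)^t* = (laplacian C G)^T.
Proof. by apply/matrixP=> i j; rewrite [LHS]mxE [RHS]mxE [in LHS]mxE laplacianE rmorph_int. Qed.

Lemma sum_ord (F : vertex G -> int) :
  \sum_(i < n) ((F (enum_val i))%:~R : C) = (\sum_x F x)%:~R.
Proof.
rewrite rmorph_sum /=.
by rewrite [RHS](reindex (fun i : 'I_n => enum_val i)) //; apply/onW_bij/enum_val_bij.
Qed.

Lemma normal_digraphP : normal_digraph C G <-> forall x y, defect x y = 0.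
Proof.
have entry i j : (laplacian C G *m (laplacian C G)^t* - (laplacian C G)^t* *m laplacian C G) i j
    = (defect (enum_val i) (enum_val j))%:~R.
  rewrite laplacian_real /defect -sum_ord mxE [X in X + _]mxE [X in _ + X]mxE [X in _ - X]mxE.
  rewrite -sumrB; apply: eq_bigr => k _.
  by rewrite [(_^T) k j]mxE [(_^T) i k]mxE !laplacianE [RHS]rmorphB !rmorphM.
split=> [/normalmxP nL x y|d0].
  have := entry (enum_rank x) (enum_rank y); rewrite nL subrr mxE !enum_rankK.
  by move/esym/eqP; rewrite intr_eq0 => /eqP.
apply/normalmxP/eqP; rewrite -subr_eq0; apply/eqP/matrixP=> i j.
by rewrite entry d0 mxE.
Qed.

Lemma restricted_normal_defect : restricted_normal C G -> forall x y,
  n%:Z * (2 * defect x y - excess x - excess y) = (excess x - excess y) ^+ 2.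
Proof.
case=> _ [Q resQ nQ] x y.
have n_gt0 : (0 < n)%N by apply/card_gt0P; exists x.
have row0 i : \sum_j laplacian C G i j = 0.
  by under eq_bigr do rewrite laplacianE; rewrite sum_ord sum_lap_row.
have sqE (a b : int) : ((a - b) ^+ 2)%:~R = (a%:~R - b%:~R) ^+ 2 :> C.
  by rewrite rmorphXn rmorphB.
have sumE (F : 'I_n -> C) (f : vertex G -> int) :
    (forall k, F k = (f (enum_val k))%:~R) -> \sum_k F k = (\sum_z f z)%:~R.
  by move=> Ff; rewrite -sum_ord; apply: eq_bigr.
have rowsqE : \sum_k (laplacian C G (enum_rank x) k - laplacian C G (enum_rank y) k) ^+ 2
    = (\sum_z (lap x z - lap y z) ^+ 2)%:~R.
  by apply: sumE => k; rewrite !laplacianE !enum_rankK sqE.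
have colsqE : \sum_k (laplacian C G k (enum_rank x) - laplacian C G k (enum_rank y)) ^+ 2
    = (\sum_z (lap z x - lap z y) ^+ 2)%:~R.
  by apply: sumE => k; rewrite !laplacianE !enum_rankK sqE.
have colE v : \sum_k laplacian C G k (enum_rank v) = (excess v)%:~R.
  by rewrite -sum_lap_col; apply: sumE => k; rewrite laplacianE enum_rankK.
have := restricted_normal_entries n_gt0 resQ nQ laplacian_real row0 (enum_rank x) (enum_rank y).
rewrite rowsqE colsqE !colE.
have n_neq0 : n%:R != 0 :> C by rewrite pnatr_eq0 -lt0n.
move/(congr1 (fun c => n%:R * c)); rewrite /= mulrBr mulVKf // => /eqP.
rewrite -sqE -[n%:R]/((n%:Z)%:~R) -!intrM -intrB eqr_int => /eqP eqn.
(* Polarization: the squares give the diagonal defects, which are the excesses, and the cross terms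
   give [defect x y]. *)
suff sq : \sum_z (lap x z - lap y z) ^+ 2 - \sum_z (lap z x - lap z y) ^+ 2
    = excess x + excess y - 2 * defect x y.
  move/eqP: sq; rewrite subr_eq => /eqP sq; rewrite sq in eqn.
  by move: (\sum_z _) eqn => b eqn; lia.
rewrite -!defect_diag /defect mulr_sumr -!sumrB -!big_split /= -sumrB.
by apply: eq_bigr => z _; ring.
Qed.

End Laplacian.

(** * Induced subdigraphs and joins *)

(** A scalar shift of a matrix adds the same terms [b (l + l^T) + b^2] to both of its Gram
    products. *)
Lemma gram_defect_scalar (T : finType) (l : T -> T -> int) (b : int) u v :
  \sum_w ((l u w + b * (u == w)%:R) * (l v w + b * (v == w)%:R) -
          (l w u + b * (w == u)%:R) * (l w v + b * (w == v)%:R)) =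
  \sum_w (l u w * l v w - l w u * l w v).
Proof.
rewrite (eq_bigr (fun w => (l u w * l v w - l w u * l w v) +
    ((u == w)%:R * (b * l v w) + (v == w)%:R * (b * l u w) -
     (w == u)%:R * (b * l w v) - (w == v)%:R * (b * l w u)) +
    ((u == w)%:R * (b ^+ 2 * (v == w)%:R) -
     (w == u)%:R * (b ^+ 2 * (w == v)%:R)))); last first.
  by move=> w _; ring.
rewrite !big_split /= !sumrN !sum_deltal !sum_deltar.
by rewrite (eq_sym u v); ring.
Qed.

Section Induced.
Variables (G : digraph) (A : {set vertex G}).

Definition induced_edge : rel {x : vertex G | x \in A} := fun u v => edge (val u) (val v).

Lemma induced_edge_irrefl : irreflexive induced_edge.
Proof. by move=> u; apply: edge_irrefl. Qed.

Definition induced : digraph := Digraph induced_edge_irrefl.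

Lemma sum_induced (F : vertex G -> int) : \sum_(u : vertex induced) F (val u) = \sum_(x in A) F x.
Proof. by rewrite [RHS]big_sub. Qed.

Lemma sum_split (F : vertex G -> int) :
  \sum_x F x = \sum_(u : vertex induced) F (val u) + \sum_(x in ~: A) F x.
Proof.
rewrite sum_induced (bigID (mem A)) /=; congr (_ + _).
by apply: eq_bigl => x; rewrite inE.
Qed.

(** Arcs leaving [A] shift the Laplacian of the block by a scalar, which does not affect the defect;
    each outside vertex then contributes [r^2 - s^2 = r - s]. The two booleans let one lemma serve
    both sides of a join. *)
Lemma defect_induced (r s : bool) :
    {in A & ~: A, forall x z, edge x z = r /\ edge z x = s} ->
  forall u v : vertex induced,
  defect (val u) (val v) = defect u v + (r%:R - s%:R) * #|~: A|%:R.
Proof.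
move=> rs u v; set m : int := #|~: A|%:R.
have degE (w : vertex induced) : (outdegree (val w))%:R = (outdegree w)%:R + r%:R * m :> int.
  rewrite -!sum_edge sum_split; congr (_ + _).
  rewrite (eq_bigr (fun=> r%:R)); last by move=> z zA; have [-> _] := rs _ _ (valP w) zA.
  by rewrite sumr_const mulr_natr.
have lapE (w t : vertex induced) : lap (val w) (val t) = lap w t + r%:R * m * (w == t)%:R.
  by rewrite /lap degE (inj_eq val_inj) /=; ring.
have lap_out (w : vertex induced) z : z \in ~: A ->
    lap (val w) z = - r%:R /\ lap z (val w) = - s%:R.
  move=> zA; have [er es] := rs _ _ (valP w) zA.
  have wz : val w != z by apply: contraTneq zA => <-; rewrite inE (valP w).
  by rewrite /lap er es (eq_sym z) (negPf wz) !mulr0 !add0r.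
rewrite /defect sum_split; congr (_ + _); last first.
  rewrite (eq_bigr (fun=> r%:R - s%:R)) ?sumr_const ?mulr_natr // => z zA.
  have [-> ->] := lap_out u z zA; have [-> ->] := lap_out v z zA.
  by case: r s {rs degE lapE lap_out} => [] [].
rewrite -[RHS](gram_defect_scalar _ (r%:R * m)).
by apply: eq_bigr => w _; rewrite !lapE.
Qed.

End Induced.

Lemma join_of_induced (G : digraph) (A : {set vertex G}) :
    {in A & ~: A, forall x z, edge x z /\ ~~ edge z x} ->
  isomorphic G (directed_join (induced A) (induced (~: A))).
Proof.
move=> eA.
(* Matching on the reflection proof supplies the membership proof that the subtype requires. *)
pose f (x : vertex G) : vertex (directed_join (induced A) (induced (~: A))) :=
  match @idP (x \in A) with
  | ReflectT xA => inl (exist _ x xA)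
  | ReflectF xNA => inr (exist _ x (introT setCP xNA))
  end.
pose g (u : vertex (directed_join (induced A) (induced (~: A)))) : vertex G :=
  match u with inl u => val u | inr u => val u end.
exists f.
  exists g => [x|[[x xA]|[x xA]]].
  - by rewrite /f; case: {-}_ / idP.
  - rewrite /g /f /=; case: {-}_ / idP => // xA'.
    by congr inl; apply: val_inj.
  - rewrite /g /f /=; case: {-}_ / idP => [xA'|xNA].
      by case/setCP: (xA).
    by congr inr; apply: val_inj.
move=> x y; rewrite /f; case: {-}_ / idP => xA; case: {-}_ / idP => yA //=.
  by have [->] := eA x y xA (introT setCP yA).
by have [_ /negPf->] := eA y x yA (introT setCP xA).
Qed.

(** * Extremal values of the excess *)

Lemma sumr_ge0_eq0 (T : finType) (F : T -> int) :
  (forall t, 0 <= F t) -> \sum_t F t = 0 -> forall t, F t = 0.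
Proof. by move=> F0 sF t; apply: (psumr_eq0P (P := predT) _ sF). Qed.

Section Excess.
Variable G : digraph.
Implicit Types x y z : vertex G.
Local Notation n := (digraph_order G).

(** Each of the [n - 1] other vertices contributes at most 1 in absolute value, and [x] itself
    contributes 0. *)
Lemma ltz_excess x : `|excess x| < n%:Z.
Proof.
rewrite /excess (bigD1 x) //= subrr add0r.
apply: le_lt_trans (ler_norm_sum _ _ _) _.
apply: (@le_lt_trans _ _ (\sum_(y | y != x) 1)).
  by apply: ler_sum => y _; case: edge; case: edge.
rewrite sumr_const cardC1 natz ltz_nat /digraph_order ltn_predL.
by apply/card_gt0P; exists x.
Qed.

(* The excesses sum over A to the number of edges leaving A minus the number
   of edges entering A, so this maximal value forces all of the former and
   none of the latter. *)
Lemma excess_join (A : {set vertex G}) :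
    {in A, forall x, excess x = #|~: A|%:Z} ->
  {in A & ~: A, forall x z, edge x z /\ ~~ edge z x}.
Proof.
move=> cA.
pose F x y : int := (edge x y)%:R - (edge y x)%:R.
have sumF : \sum_(x in A) \sum_(y in ~: A) F x y = \sum_(x in A) #|~: A|%:Z.
  rewrite -(eq_bigr _ cA) /excess; under [RHS]eq_bigr do rewrite (bigID (mem A)) /=.
  rewrite big_split /= [X in _ = X + _](_ : _ = 0) ?add0r.
    by apply: eq_bigr => x _; apply: eq_bigl => y; rewrite inE.
  under eq_bigr do rewrite sumrB.
  by rewrite sumrB [X in X - _]exchange_big subrr.
have F_le1 x y : 0 <= 1 - F x y by rewrite /F; case: edge; case: edge.
have F_sum : \sum_(x in A) \sum_(y in ~: A) (1 - F x y) = 0.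
  under eq_bigr do rewrite sumrB sumr_const.
  by rewrite sumrB sumF natz subrr.
move=> x z xA zA.
have Fx0 := psumr_eq0P (fun x _ => sumr_ge0 _ (fun y _ => F_le1 x y)) F_sum xA.
have := psumr_eq0P (fun y _ => F_le1 x y) Fx0 zA.
by rewrite /F; case: edge; case: edge.
Qed.

End Excess.

(** * Splitting the vertices by the sign of the excess *)

Theorem theorem3p10 (C : numClosedFieldType) (G : digraph) (n : nat)
    (hn : digraph_order G = n)
    (hsf : square_free n \/ exists2 m : nat, square_free m & n = (2 * m)%N)
    (hG : restricted_normal C G) :
  exists G1 G2 : digraph,
    [/\ (0 < digraph_order G1)%N, (0 < digraph_order G2)%N,
        normal_digraph C G1, normal_digraph C G2 &
        isomorphic G (directed_join G1 G2)].
Proof.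
have defectE := restricted_normal_defect hG; rewrite hn in defectE.
have dvd_excess (x y : vertex G) : (n %| excess x - excess y)%Z.
  (* This [z] makes [d + 2 * z] equal to [2 * defect x y - excess x - excess y] for
     [d = excess x - excess y]. *)
  apply: (dvdz_of_sqr_eq (z := defect x y - excess x) hsf).
  by rewrite -defectE; congr (_ * _); ring.
have excess_lt (x : vertex G) : `|excess x| < n%:Z by rewrite -hn ltz_excess.
have excess_close (x y : vertex G) : `|excess x - excess y| < n%:Z -> excess x = excess y.
  have /dvdzP[q Eq] := dvd_excess x y; rewrite Eq normrM [`|n%:Z|]ger0_norm //= => lt_qn.
  have q0 : q = 0 by nia.
  by move: Eq; rewrite q0 mul0r => /eqP; rewrite subr_eq0 => /eqP.
have not_all0 : ~ (forall x : vertex G, excess x = 0).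
  move=> c0; case: hG => nN _; apply/nN/normal_digraphP => x y.
  have n_gt0 : n%:Z != 0 by have := excess_lt x; lia.
  by apply: (mulfI n_gt0); move: (defectE x y); rewrite !c0; lia.
(* A zero excess lies within [n] of every other one, so all would vanish. *)
have excess_neq0 (x : vertex G) : excess x != 0.
  apply/eqP => cx; apply: not_all0 => y.
  by rewrite -[RHS]cx; apply: excess_close; rewrite cx subr0.
pose A := [set x : vertex G | 0 < excess x].
have [x1 x1A] : exists x, x \in A.
  apply/set0Pn; apply/negP => /eqP A0; apply: not_all0 => x; apply: oppr_inj.
  rewrite oppr0; apply: (sumr_ge0_eq0 (F := fun x => - excess x)) x.
    by move=> x; have := in_set0 x; rewrite -A0 inE; lia.
  by rewrite sumrN excess_sum oppr0.
have [x2 x2A] : exists x, x \in ~: A.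
  apply/set0Pn; apply/negP => /eqP A0; apply: not_all0.
  apply: sumr_ge0_eq0 (excess_sum G) => x.
  by have := in_set0 x; rewrite -A0 !inE; lia.
have cardA : #|A|%:Z + #|~: A|%:Z = n by rewrite -PoszD cardsC -hn.
have cA0 : {in A, forall x, excess x = excess x1}.
  move=> x xA; apply: excess_close; move: xA x1A (excess_lt x) (excess_lt x1).
  by rewrite !inE; lia.
(* Off [A] the excess is negative, so its distance from [excess x1] is a multiple of [n] strictly
   between 0 and [2n]. *)
have cNA0 : {in ~: A, forall x, excess x = excess x1 - n%:Z}.
  move=> x xA; have /dvdzP[q Eq] := dvd_excess x1 x.
  move: xA x1A (excess_lt x) (excess_lt x1) (excess_neq0 x).
  rewrite !inE => cx c1 bx b1 cn0.
  have q1 : q = 1 by nia.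
  by move: Eq; rewrite q1; lia.
(* The zero total reads [|A| c1 + |~A| (c1 - n) = n (c1 - |~A|)], writing [c1] for [excess x1]. *)
have c1 : excess x1 = #|~: A|%:Z.
  have := excess_sum G; rewrite (bigID (mem A)) /= (eq_bigr _ cA0).
  rewrite [X in _ + X](eq_bigl (mem (~: A))); last by move=> x; rewrite !inE.
  rewrite (eq_bigr _ cNA0) !sumr_const -[X in X + _]mulr_natr -[X in _ + X]mulr_natr !natz => sum0.
  have n_neq0 : n%:Z != 0 by have := excess_lt x1; lia.
  apply: (mulfI n_neq0); apply/eqP; rewrite -subr_eq0 -sum0; apply/eqP.
  by rewrite -cardA; ring.
have cA : {in A, forall x, excess x = #|~: A|%:Z} by move=> x /cA0 ->.
have cNA : {in ~: A, forall x, excess x = - #|A|%:Z}.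
  by move=> x /cNA0 ->; rewrite c1 -cardA; ring.
have defect_same (x y : vertex G) : excess x = excess y -> defect x y = excess x.
  move=> cxy; have n_gt0 : n%:Z != 0 by have := excess_lt x; lia.
  apply: (mulfI n_gt0); have := defectE x y; rewrite -cxy subrr expr0n /=; lia.
have joinA := excess_join cA.
exists (induced A), (induced (~: A)); split.
- by rewrite /digraph_order; apply/card_gt0P; exists (exist _ x1 x1A).
- by rewrite /digraph_order; apply/card_gt0P; exists (exist _ x2 x2A).
- apply/normal_digraphP => u v.
  have rs : {in A & ~: A, forall x z, edge x z = true /\ edge z x = false}.
    by move=> x z xA zA; have [-> /negPf->] := joinA x z xA zA.
  have := defect_induced rs u v; have cu := cA _ (valP u); have cv := cA _ (valP v).
  by rewrite defect_same cu ?cv //= natz; lia.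
(* Seen from [~: A] all join arcs enter, so the correction is [- |A|], again the common excess. *)
- apply/normal_digraphP => u v.
  have rs : {in ~: A & ~: ~: A, forall x z, edge x z = false /\ edge z x = true}.
    by move=> x z xA; rewrite setCK => zA; have [-> /negPf->] := joinA z x zA xA.
  have := defect_induced rs u v; have cu := cNA _ (valP u); have cv := cNA _ (valP v).
  by rewrite setCK defect_same cu ?cv //= natz; lia.
exact: join_of_induced.
Qed.
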